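(* Any recursively enumerable set (of non-negative integers) can be recognized by an $\mathrm{ARAM}[+,/,\leftarrow,\mathit{Bool}]$ in $O(1)$ time.
   Context: RAM model. A random access machine $\mathrm{RAM}[op]$ has infinitely many registers $R[0],R[1],\dots$ holding non-negative integers. A program is a finite list of labelled commands (execution starts at label 1 and proceeds sequentially except at comparisons and jumps). Commands are: assignments (apply a $k$-ary operation from $op$ to $k$ operands and store the result in a target register), comparisons (test two operands for equality and proceed to one of two labels according to the result), unconditional jumps, and halts. Each operand is either an explicit constant from $\{0,1\}$ or the contents of an explicitly named register; indirect addressing is not available. Each command takes one unit of time. Inputs are placed in the first registers, all other registers are initialized to $0$, and the output is the content of the first register on termination. Operations: $a/b$ is exact division, equal to integer division but defined only when $b$ divides $a$ exactly; $a\leftarrow b=a\cdot 2^b$; $\mathit{Bool}$ is the set of all bitwise Boolean functions, where negation is modified so that $\neg a$ negates the bits of $a$ only up to and including its most significant $1$ bit. ARAM (RAM assisted by an arbitrary large number). A set $S$ of non-negative integers is computable (recognized) by an $\mathrm{ARAM}[op]$ in $f(n)$ time if there exists a Boolean function $g(inp,x)$, computable in $f(n)$ time on a $\mathrm{RAM}[op]$ (where $n$ is the bit-length of $inp$), such that $inp\in S$ implies $g(inp,x)\neq 0$ for all but finitely many non-negative integers $x$, and $inp\notin S$ implies $g(inp,x)=0$ for all but finitely many $x$. *)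

(* Defs.v *)
From mathcomp Require Import all_boot.

Set Implicit Arguments.
Unset Strict Implicit.
Unset Printing Implicit Defensive.

(* [interp] is partial because exact division is.  *)
Record signature := Signature {
  symbol : Type;
  arity : symbol -> nat;
  interp : forall o : symbol, (arity o).-tuple nat -> option nat }.

Inductive operand := Const (b : bool) | Reg (i : nat).

Inductive command (op : signature) :=
  | Assign (target : nat) (o : symbol op) (args : (arity o).-tuple operand)
  | Compare (a b : operand) (if_eq if_neq : nat)
  | Jump (label : nat)
  | Halt.

Definition program (op : signature) := seq (command op).

Definition registers := nat -> nat.

Definition value (r : registers) (a : operand) : nat :=
  match a with Const b => b | Reg i => r i end.

(* Labels start at 1.  *)
Definition fetch (op : signature) (p : program op) (label : nat) :
    option (command op) :=
  if label is l.+1 then onth p l else None.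

(* [exec p t l r] is [Some y] iff [p], started at label [l] with registers [r],
   terminates with output [y] after executing at most [t] commands, the final
   [Halt] included.  Applying an operation outside its domain, or reaching a
   label that carries no command, is not termination.  *)
Fixpoint exec (op : signature) (p : program op) (t label : nat)
    (r : registers) : option nat :=
  if t is t'.+1 then
    match fetch p label with
    | Some (Assign target o args) =>
        if interp (map_tuple (value r) args) is Some y
        then exec p t' label.+1 [eta r with target |-> y]
        else None
    | Some (Compare a b if_eq if_neq) =>
        exec p t' (if value r a == value r b then if_eq else if_neq) r
    | Some (Jump l) => exec p t' l r
    | Some (Halt) => Some (r 0)
    | None => None
    end
  else None.

Definition outputs_within (op : signature) (p : program op) (t : nat)
    (inputs : seq nat) (y : nat) : Prop :=
  exec p t 1 (nth 0 inputs) = Some y.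

Definition bit_length (a : nat) : nat := up_log 2 a.+1.

Definition all_but_finitely_many (P : nat -> Prop) : Prop :=
  exists exceptions : seq nat, forall x, x \notin exceptions -> P x.

Definition aram_recognizes (op : signature) (S : nat -> Prop)
    (f : nat -> nat) : Prop :=
  exists g : nat -> nat -> bool,
    (exists p : program op, forall inp x : nat,
        outputs_within p (f (bit_length inp)) [:: inp; x] (g inp x)) /\
    (forall inp : nat,
        (S inp -> all_but_finitely_many (fun x => g inp x = true)) /\
        (~ S inp -> all_but_finitely_many (fun x => g inp x = false))).

Definition bigO (f h : nat -> nat) : Prop :=
  exists c n0 : nat, forall n, n0 <= n -> f n <= c * h n.

Definition bit (a i : nat) : bool := odd (a %/ 2 ^ i).

(* Bits are computed only below the largest bit length of the operands.  This
   loses nothing when [beta] maps the all-false tuple to false; otherwise it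
   keeps the result finite, and for [k = 1] and [beta] negation it negates the
   operand's bits up to and including its most significant 1.  *)
Definition bitwise (k : nat) (beta : k.-tuple bool -> bool)
    (v : k.-tuple nat) : nat :=
  \sum_(i < \max_(j < k) bit_length (tnth v j))
    beta (map_tuple (bit^~ i) v) * 2 ^ i.

Definition exact_div (a b : nat) : option nat :=
  if (0 < b) && (b %| a) then Some (a %/ b) else None.

Inductive arith_symbol :=
  | Plus
  | ExactDiv
  | ShiftLeft
  | Bool (k : nat) (beta : k.-tuple bool -> bool).

Definition arith_arity (o : arith_symbol) : nat :=
  if o is @Bool k _ then k else 2.

Definition arith_interp (o : arith_symbol) :
    (arith_arity o).-tuple nat -> option nat :=
  match o with
  | Plus => fun v : 2.-tuple nat => Some ([tnth v 0] + [tnth v 1])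
  | ExactDiv => fun v : 2.-tuple nat => exact_div [tnth v 0] [tnth v 1]
  | ShiftLeft => fun v : 2.-tuple nat => Some ([tnth v 0] * 2 ^ [tnth v 1])
  | Bool k beta => fun v : k.-tuple nat => Some (bitwise beta v)
  end.

Definition add_div_shift_bool : signature := Signature arith_interp.

Inductive recfun : nat -> Type :=
  | Zero n : recfun n
  | Succ : recfun 1
  | Proj n (i : 'I_n) : recfun n
  | Comp n k (f : recfun k) (h : 'I_k -> recfun n) : recfun n
  | PrimRec n (f : recfun n) (h : recfun n.+2) : recfun n.+1
  | Mu n (f : recfun n.+1) : recfun n.

(* [evaluates f v y] is the graph of the partial function denoted by [f].  In
   [PrimRec] the recursion variable comes first, and [h] receives the current
   index, the value at that index and the parameters, in this order.  In [Mu],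
   all values below the result must be defined (and nonzero).  *)
Fixpoint evaluates n (f : recfun n) : n.-tuple nat -> nat -> Prop :=
  match f in recfun n return n.-tuple nat -> nat -> Prop with
  | Zero _ => fun _ y => y = 0
  | Succ => fun v y => y = (thead v).+1
  | Proj _ i => fun v y => y = tnth v i
  | Comp _ k f h => fun v y =>
      exists w : k.-tuple nat,
        (forall i, evaluates (h i) v (tnth w i)) /\ evaluates f w y
  | PrimRec _ f h => fun v =>
      let params := [tuple of behead v] in
      (fix rec (m y : nat) : Prop :=
         if m is m'.+1 then
           exists z, rec m' z /\ evaluates h [tuple of [:: m', z & params]] y
         else evaluates f params y) (thead v)
  | Mu _ f => fun v y =>
      evaluates f [tuple of y :: v] 0 /\
      (forall z, z < y -> exists a, evaluates f [tuple of z :: v] a.+1)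
  end.

Definition recursively_enumerable (S : nat -> Prop) : Prop :=
  exists f : recfun 1, forall a : nat,
    S a <-> exists y, evaluates f [tuple a] y.

(* Main.v *)
Require Import Defs.
From mathcomp Require Import all_boot.
From mathcomp Require Import zify ring.

(** The graph of a partial recursive function is described by a first-order
    formula over the numbers below [2 ^ M], with the order and Ackermann's
    membership relation (a bit test) as only predicates: each evaluation is
    witnessed below [2 ^ M] once [M] is large, and what is witnessed below some
    [2 ^ M] is an evaluation.  With [M = inp + x] it remains to decide a fixed
    formula in a constant number of operations.  Its truth table, and the tables
    of the values of its variables, are packed into single numbers with fields
    of [2 ^ M] bits.  Exact division by [2 ^ s - 1] multiplies by a geometric sum
    of powers of [2 ^ s], which replicates tables and adds up their blocks;
    sums, differences and masks then act on all the fields at once, and a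
    quantifier is an addition of blocks followed by a test against zero. *)

Set Implicit Arguments.
Unset Strict Implicit.
Unset Printing Implicit Defensive.

(** * Bits *)

Lemma bit_split w a b i : a < 2 ^ w ->
  bit (a + b * 2 ^ w) i = if i < w then bit a i else bit b (i - w).
Proof.
move=> ltaw; rewrite /bit; case: ltnP => [ltiw|leiw].
  have -> : b * 2 ^ w = b * 2 ^ (w - i) * 2 ^ i.
    by rewrite -mulnA -expnD subnK // ltnW.
  rewrite divnDMl ?expn_gt0 // oddD oddM oddX -subn_gt0 in ltiw *.
  by rewrite orbF eqn0Ngt ltiw andbF addbF.
by rewrite -{1}(subnKC leiw) expnD divnMA divnDMl ?expn_gt0 // (divn_small ltaw).
Qed.

Lemma bit_small w a i : a < 2 ^ w -> w <= i -> bit a i = false.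
Proof.
move=> ltaw lewi; rewrite /bit divn_small //.
by apply: leq_trans ltaw _; rewrite leq_exp2l.
Qed.

Lemma bit0n i : bit 0 i = false. Proof. by rewrite /bit div0n. Qed.

Lemma bit_pow2 n i : bit (2 ^ n) i = (i == n).
Proof.
rewrite -[2 ^ n]mul1n -[1 * _]add0n bit_split ?expn_gt0 // bit0n.
case: ltngtP => [//|lt|->]; last by rewrite subnn.
by rewrite (@bit_small 1) ?subn_gt0.
Qed.

Lemma bit_bool (b : bool) i : bit b i = (i == 0) && b.
Proof.
case: i => [|i]; first by rewrite /bit divn1 oddb.
by rewrite /= (@bit_small 1) //; case: b.
Qed.

Lemma bit_lt w a i : a < 2 ^ w -> bit a i -> i < w.
Proof. by move=> lta; apply: contraLR; rewrite -leqNgt => /(bit_small lta)->. Qed.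

Lemma bit_inj a b : bit a =1 bit b -> a = b.
Proof.
have [n] := ubnP (a + b); elim: n a b => // n IHn a b leabn eqab.
have bitS c i : bit c i.+1 = bit c./2 i by rewrite /bit expnS divnMA divn2.
rewrite -[a]odd_double_half -[b]odd_double_half.
have := eqab 0; rewrite /bit !divn1 => ->; congr (_ + _.*2).
have [ab0|nz] := posnP (a + b); first by have -> : a = b by lia.
by apply: IHn => [|i]; [lia | rewrite -!bitS].
Qed.

Lemma bits_lt w a : (forall i, w <= i -> bit a i = false) -> a < 2 ^ w.
Proof.
move=> a0; suff -> : a = a %% 2 ^ w by rewrite ltn_mod expn_gt0.
have lt : a %% 2 ^ w < 2 ^ w by rewrite ltn_mod expn_gt0.
apply: bit_inj => i; have [ltiw|lewi] := ltnP i w.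
  by rewrite {1}(divn_eq a (2 ^ w)) addnC bit_split // ltiw.
by rewrite a0 // (bit_small lt).
Qed.

Lemma sum_bits_lt n (f : nat -> bool) : \sum_(i < n) f i * 2 ^ i < 2 ^ n.
Proof.
elim: n => [|n IHn]; first by rewrite big_ord0.
rewrite big_ord_recr /= expnS mul2n -addnn -addSn leq_add //.
by rewrite -[leqRHS]mul1n leq_mul2r leq_b1 orbT.
Qed.

Lemma bit_sum_bits n (f : nat -> bool) j :
  bit (\sum_(i < n) f i * 2 ^ i) j = (j < n) && f j.
Proof.
elim: n => [|n IHn]; first by rewrite big_ord0 bit0n.
rewrite big_ord_recr /= bit_split ?sum_bits_lt // IHn ltnS.
case: ltngtP => //= [ltnj|->].
  by apply: (@bit_small 1); rewrite ?subn_gt0 //; case: (f n).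
by rewrite subnn /bit divn1 oddb.
Qed.

Lemma ltn_pow_bit_length a : a < 2 ^ bit_length a.
Proof. exact: up_logP. Qed.

Definition bitwise2 (beta : bool -> bool -> bool) (a b : nat) : nat :=
  bitwise (fun t : 2.-tuple bool => beta (nth false t 0) (nth false t 1))
    [tuple a; b].

Lemma bitwise2E beta a b : bitwise2 beta a b =
  \sum_(i < maxn (bit_length a) (bit_length b)) beta (bit a i) (bit b i) * 2 ^ i.
Proof.
rewrite /bitwise2 /bitwise !big_ord_recl big_ord0 maxn0.
by rewrite !(tnth_nth 0) /=.
Qed.

(** Beyond the bit lengths of both operands [beta] would only see two false bits, so truncating
    there changes nothing. *)
Lemma bit_bitwise2 beta a b i : beta false false = false ->
  bit (bitwise2 beta a b) i = beta (bit a i) (bit b i).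
Proof.
move=> beta0; rewrite bitwise2E.
rewrite (bit_sum_bits _ (fun i => beta (bit a i) (bit b i))).
case: ltnP => //; rewrite geq_max => /andP[lea leb].
by rewrite (bit_small _ lea) ?(bit_small _ leb) ?ltn_pow_bit_length.
Qed.

(** Bitwise operations have no carries, so adjacent fields are processed independently; hence one
    command can act on a whole packed table. *)
Lemma bitwise2_split beta w a b c d : beta false false = false ->
  a < 2 ^ w -> c < 2 ^ w ->
  bitwise2 beta (a + b * 2 ^ w) (c + d * 2 ^ w) =
  bitwise2 beta a c + bitwise2 beta b d * 2 ^ w.
Proof.
move=> beta0 lta ltc; apply: bit_inj => i.
have ltac : bitwise2 beta a c < 2 ^ w.
  by apply: bits_lt => j lej; rewrite bit_bitwise2 // (bit_small lta) ?(bit_small ltc).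
rewrite !(bit_split, bit_bitwise2) //; case: ifP => _ //.
Qed.

Definition land := bitwise2 andb.
Definition landn := bitwise2 (fun x y => x && ~~ y).

Lemma land_lt w a b : a < 2 ^ w -> land a b < 2 ^ w.
Proof.
by move=> lta; apply: bits_lt => i lei; rewrite bit_bitwise2 // (bit_small lta).
Qed.

Lemma land0r a : land a 0 = 0.
Proof. by apply: bit_inj => i; rewrite bit_bitwise2 // bit0n andbF. Qed.

Lemma sum_pow2 n : \sum_(i < n) 2 ^ i = (2 ^ n).-1.
Proof. by rewrite predn_exp mul1n. Qed.

Lemma bit_pred_pow2 n i : bit (2 ^ n).-1 i = (i < n).
Proof.
rewrite -sum_pow2 -[RHS]andbT -(bit_sum_bits n xpredT).
by congr bit; apply: eq_bigr => j _; rewrite mul1n.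
Qed.

Lemma land_pred_pow2 w a : a < 2 ^ w -> land a (2 ^ w).-1 = a.
Proof.
move=> lta; apply: bit_inj => i; rewrite bit_bitwise2 // bit_pred_pow2.
by case: ltnP => [|/(bit_small lta)->]; rewrite ?andbT.
Qed.

(** Subtracting from a number whose bits are all ones never borrows. The induction peels off the
    lowest bit. *)
Lemma landn_pred_pow2 w a : a < 2 ^ w -> landn (2 ^ w).-1 a = (2 ^ w).-1 - a.
Proof.
move=> lta; set b := landn _ a.
suff <- : a + b = (2 ^ w).-1 by rewrite addKn.
elim: w a lta @b => [|w IHw] a lta.
  by case: a lta => //= _; apply: bit_inj => i; rewrite bit_bitwise2 // !bit0n.
rewrite /=.
have powE : (2 ^ w.+1).-1 = 1 + (2 ^ w).-1 * 2 ^ 1.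
  by rewrite expnS; have := expn_gt0 2 w; lia.
have aE : a = odd a + a./2 * 2 ^ 1 by rewrite expn1 muln2 odd_double_half.
rewrite powE {2}aE /landn bitwise2_split //; last by case: (odd a).
have := IHw a./2; rewrite /landn; set c := bitwise2 _ _ a./2 => IH.
have {}IH : a./2 + c = (2 ^ w).-1 by apply: IH; move: lta; rewrite expnS; lia.
suff -> : bitwise2 (fun x y => x && ~~ y) 1 (odd a) = ~~ odd a by lia.
apply: bit_inj => i; rewrite bit_bitwise2 //.
by rewrite (bit_bool true) !bit_bool; case: eqP => //=; rewrite ?andbF.
Qed.

(** The truncation at the bit length [n.+1] is what matters: the leading one is cleared and the [n]
    zeros below it are set. This is the first source of subtraction. *)
Lemma nor_pow2 n : bitwise2 (fun x y => ~~ (x || y)) (2 ^ n) 0 = (2 ^ n).-1.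
Proof.
rewrite bitwise2E.
have -> : bit_length (2 ^ n) = n.+1.
  by apply: up_log_eq; rewrite // ltnSn ltn_exp2l /=.
rewrite /bit_length up_log1 maxn0 big_ord_recr /= -sum_pow2.
rewrite bit_pow2 eqxx mul0n addn0.
by apply: eq_bigr => i _; rewrite bit0n orbF bit_pow2 ltn_eqF // mul1n.
Qed.

(** The quotient of [n] by [2 ^ w] is 0 or 1, so masking the top bit decides a comparison. *)
Lemma land_pow2 n w : n < 2 ^ w.+1 -> land n (2 ^ w) = (2 ^ w <= n) * 2 ^ w.
Proof.
move=> ltn; rewrite {1}(divn_eq n (2 ^ w)) addnC.
rewrite -[X in land _ X]mul1n -[X in land _ X]add0n.
rewrite /land bitwise2_split ?expn_gt0 ?ltn_mod ?expn_gt0 //.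
rewrite -/(land _ _) land0r add0n; congr (_ * _).
have : n %/ 2 ^ w < 2 by rewrite ltn_divLR ?expn_gt0 // -expnS.
rewrite -[2 ^ w <= n]divn_gt0 ?expn_gt0 //.
case: (n %/ _) => [|[|]] // _; apply: bit_inj => i; rewrite bit_bitwise2 //.
  by rewrite bit0n.
by rewrite andbb.
Qed.

(** * Straight-line programs *)

(** Without branching, the number of commands depends on the expression alone and not on the inputs,
    which gives constant time. *)
Inductive expr :=
  | Input (second : bool)
  | Constant (b : bool)
  | Add (e1 e2 : expr)
  | Div (e1 e2 : expr)
  | Shl (e1 e2 : expr)
  | Bitwise (beta : bool -> bool -> bool) (e1 e2 : expr).

Definition obind2 (f : nat -> nat -> option nat) (x y : option nat) :=
  if x is Some a then if y is Some b then f a b else None else None.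

Fixpoint denote (e : expr) (p : nat * nat) : option nat :=
  match e with
  | Input b => Some (if b then p.2 else p.1)
  | Constant b => Some (b : nat)
  | Add e1 e2 =>
      obind2 (fun a b => Some (a + b)) (denote e1 p) (denote e2 p)
  | Div e1 e2 => obind2 exact_div (denote e1 p) (denote e2 p)
  | Shl e1 e2 =>
      obind2 (fun a b => Some (a * 2 ^ b)) (denote e1 p) (denote e2 p)
  | Bitwise beta e1 e2 =>
      obind2 (fun a b => Some (bitwise2 beta a b)) (denote e1 p) (denote e2 p)
  end.

Notation ram := add_div_shift_bool.

Definition assign2 (d : nat) (o : symbol ram)
    (args : operand -> operand -> (arity o).-tuple operand) : command ram :=
  Assign d (args (Reg d) (Reg d.+1)).

Definition pair_tuple (a b : operand) : 2.-tuple operand := [tuple a; b].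

(** Registers from [d] on act as a stack: the first operand waits in [d] while the second is
    computed in [d.+1], and the result replaces the first. *)
Fixpoint code (e : expr) (d : nat) : program ram :=
  match e with
  | Input b =>
      [:: @Assign ram d Plus (pair_tuple (Reg b) (Const false))]
  | Constant b =>
      [:: @Assign ram d Plus (pair_tuple (Const b) (Const false))]
  | Add e1 e2 => code e1 d ++ code e2 d.+1 ++ [:: @assign2 d Plus pair_tuple]
  | Div e1 e2 =>
      code e1 d ++ code e2 d.+1 ++ [:: @assign2 d ExactDiv pair_tuple]
  | Shl e1 e2 =>
      code e1 d ++ code e2 d.+1 ++ [:: @assign2 d ShiftLeft pair_tuple]
  | Bitwise beta e1 e2 =>
      code e1 d ++ code e2 d.+1 ++
      [:: @assign2 d (@Bool 2 (fun t => beta (nth false t 0) (nth false t 1)))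
           pair_tuple]
  end.

(** Registers above [d] are scratch space. The last clause lets the fragment sit anywhere in a
    program, where it consumes exactly [size c] steps. *)
Definition runs_to (c : program ram) (d : nat) (r : registers) (y : nat) :=
  exists2 r' : registers, r' d = y /\ (forall i, i < d -> r' i = r i) &
  forall p pre post t, p = pre ++ c ++ post ->
    exec p (size c + t) (size pre).+1 r = exec p t (size pre + size c).+1 r'.

Lemma fetch_cat (pre post : program ram) c :
  fetch (pre ++ c :: post) (size pre).+1 = Some c.
Proof. by rewrite /fetch onth_cat ltnn subnn. Qed.

Lemma exec_assign p t l r d (o : symbol ram) (args : (arity o).-tuple operand) y :
  fetch p l = Some (Assign d args) ->
  interp (map_tuple (value r) args) = Some y ->
  exec p t.+1 l r = exec p t l.+1 [eta r with d |-> y].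
Proof. by move=> /= -> ->. Qed.

Lemma runs_to_assign d (o : symbol ram) (args : (arity o).-tuple operand) r y :
  interp (map_tuple (value r) args) = Some y ->
  runs_to [:: Assign d args] d r y.
Proof.
move=> evE; exists [eta r with d |-> y].
  by split=> [|i ltid] /=; [rewrite eqxx | rewrite (ltn_eqF ltid)].
by move=> p pre post t ->; rewrite addn1 (exec_assign _ (fetch_cat _ _ _) evE).
Qed.

Lemma runs_to_assign2 c1 c2 d (o : symbol ram)
    (args : operand -> operand -> (arity o).-tuple operand) r y1 y2 y :
  (forall r : registers,
     r d = y1 -> r d.+1 = y2 ->
     interp (map_tuple (value r) (args (Reg d) (Reg d.+1))) = Some y) ->
  runs_to c1 d r y1 ->
  (forall r' : registers, (forall i, i < d -> r' i = r i) ->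
    runs_to c2 d.+1 r' y2) ->
  runs_to (c1 ++ c2 ++ [:: assign2 d args]) d r y.
Proof.
move=> opE [r1 [r1d r1lt] run1] /(_ r1 r1lt)[r2 [r2d r2lt] run2].
have [r3 [r3d r3lt] run3] :
    runs_to [:: assign2 d args] d r2 y.
  by apply: runs_to_assign; apply: opE; rewrite // r2lt.
exists r3; first by split=> // i ltid; rewrite r3lt // r2lt ?r1lt // ltnW.
move=> p pre post t pE; rewrite !size_cat -!addnA.
rewrite (run1 _ _ (c2 ++ [:: assign2 d args] ++ post)) ?pE -?catA //.
rewrite -size_cat (run2 _ _ ([:: assign2 d args] ++ post)) -?catA //.
by rewrite -size_cat (run3 _ _ post) -?catA // !size_cat !addnA.
Qed.

(** The condition [1 < d] protects the two inputs, which stay in registers 0 and 1 and may be read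
    again at any time. *)
Lemma runs_to_code e p y d (r : registers) :
  denote e p = Some y -> 1 < d -> r 0 = p.1 -> r 1 = p.2 ->
  runs_to (code e d) d r y.
Proof.
elim: e y d r => [b|b|e1 IH1 e2 IH2|e1 IH1 e2 IH2|e1 IH1 e2 IH2
                 |beta e1 IH1 e2 IH2] y d r /=.
- move=> [<-] d1 r0 r1; apply: runs_to_assign.
  by rewrite /= !(tnth_nth 0) /= addn0; case: b; rewrite /= ?r0 ?r1.
- move=> [<-] d1 r0 r1; apply: runs_to_assign.
  by rewrite /= !(tnth_nth 0) /= addn0.
all: case E1: denote => [y1|] //=; case E2: denote => [y2|] //= yE d1 r0 r1.
all: apply: (@runs_to_assign2 _ _ _ _ _ _ y1 y2) (IH1 _ _ _ E1 d1 r0 r1) _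
  => [r' r'd r'd1|r' r'lt].
all: try by apply: IH2; rewrite // ?r'lt // ltnW.
all: rewrite -yE -r'd -r'd1 /= ?(tnth_nth 0) //=.
rewrite /bitwise2; congr (Some (bitwise _ _)).
exact/val_inj.
Qed.

(** A single expression serves all inputs and must be defined on each of them, so no exact division
    in it may fail. *)
Definition definable (F : nat * nat -> nat) : Prop :=
  exists e, forall p, denote e p = Some (F p).

Lemma definable_recognizes (S : nat -> Prop) (g : nat * nat -> bool) :
  definable g ->
  (forall inp, (S inp -> all_but_finitely_many (fun x => g (inp, x) = true)) /\
               (~ S inp -> all_but_finitely_many (fun x => g (inp, x) = false))) ->
  exists f : nat -> nat,
    bigO f (fun _ => 1) /\ aram_recognizes ram S f.
Proof.
(* Two further commands copy the result from register 2 to the output register 0 and halt. *)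
move=> [e eE] gS; pose c := size (code e 2) + 2.
exists (fun=> c); split; first by exists c, 0 => n _; rewrite muln1.
exists (fun inp x => g (inp, x)); split=> //.
exists (code e 2 ++ [:: @Assign ram 0 Plus (pair_tuple (Reg 2) (Const false));
                        Halt ram]) => inp x.
have [|//|//|r' [r'2 _] run] := @runs_to_code e (inp, x) _ 2 (nth 0 [:: inp; x]) (eE _).
  by [].
rewrite /outputs_within; rewrite (run _ [::] _ 2 (erefl _)) add0n.
rewrite (@exec_assign _ _ _ _ _ _ _ (g (inp, x)) (fetch_cat _ _ _)); last first.
  by rewrite /= !(tnth_nth 0) /= addn0 r'2.
rewrite -cat_rcons -(size_rcons _ (@Assign ram 0 Plus (pair_tuple (Reg 2) (Const false)))).
by rewrite /exec fetch_cat.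
Qed.

(** * Closure properties of constant-time functions *)

Lemma definable_ext F G : F =1 G -> definable F -> definable G.
Proof. by move=> eqFG [e eE]; exists e => p; rewrite eE eqFG. Qed.

Lemma definable_bool (b : bool) : definable (fun=> b).
Proof. by exists (Constant b). Qed.

Lemma definable_fst : definable fst.
Proof. by exists (Input false). Qed.

Lemma definable_snd : definable snd.
Proof. by exists (Input true). Qed.

Lemma definable_add F G :
  definable F -> definable G -> definable (fun p => F p + G p).
Proof. by move=> [e eE] [e' e'E]; exists (Add e e') => p /=; rewrite eE e'E. Qed.

Lemma definable_shl F G :
  definable F -> definable G -> definable (fun p => F p * 2 ^ G p).
Proof. by move=> [e eE] [e' e'E]; exists (Shl e e') => p /=; rewrite eE e'E. Qed.

Lemma definable_div F G : (forall p, 0 < G p) -> (forall p, G p %| F p) ->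
  definable F -> definable G -> definable (fun p => F p %/ G p).
Proof.
move=> G0 dvdGF [e eE] [e' e'E]; exists (Div e e') => p /=.
by rewrite eE e'E /= /exact_div G0 dvdGF.
Qed.

Lemma definable_bitwise2 beta F G :
  definable F -> definable G -> definable (fun p => bitwise2 beta (F p) (G p)).
Proof.
by move=> [e eE] [e' e'E]; exists (Bitwise beta e e') => p /=; rewrite eE e'E.
Qed.

Lemma definable_pow2 F : definable F -> definable (fun p => 2 ^ F p).
Proof.
move=> dF; apply: definable_ext (definable_shl (definable_bool true) dF) => p.
by rewrite mul1n.
Qed.

Lemma definable_pred_pow2 F : definable F -> definable (fun p => (2 ^ F p).-1).
Proof.
move=> /definable_pow2 dF; have d0 := definable_bool false.
by apply: definable_ext (definable_bitwise2 _ dF d0) => p; apply: nor_pow2.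
Qed.

(* Since [G <= F < 2 ^ F], complementing [G] on [F] bits gives
   [2 ^ F - 1 - G]; adding [F + 1] and masking off [2 ^ F] leaves [F - G]. *)
Lemma definable_sub F G : (forall p, G p <= F p) ->
  definable F -> definable G -> definable (fun p => F p - G p).
Proof.
move=> leGF dF dG; have dm := definable_pred_pow2 dF.
have := definable_bitwise2 andb (definable_add (definable_add dF
  (definable_bitwise2 (fun x y => x && ~~ y) dm dG)) (definable_bool true)) dm.
apply: definable_ext => p; rewrite -/(landn _ _).
have ltF : F p < 2 ^ F p by rewrite ltn_expl.
have ltG : G p < 2 ^ F p by apply: leq_ltn_trans ltF.
rewrite landn_pred_pow2 //; have leG := leGF p.
have -> : F p + ((2 ^ F p).-1 - G p) + true = F p - G p + 1 * 2 ^ F p.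
  by rewrite mul1n; lia.
rewrite -[X in bitwise2 _ _ X]addn0 -[X in bitwise2 _ _ (_ + X)](mul0n (2 ^ F p)).
have ltFG : F p - G p < 2 ^ F p by apply: leq_ltn_trans (leq_subr _ _) ltF.
rewrite bitwise2_split //; last by rewrite prednK ?expn_gt0.
by rewrite -!/(land _ _) land0r land_pred_pow2 // mul0n addn0.
Qed.

Definition geometric (s m : nat) : nat := \sum_(i < m) 2 ^ (s * i).

Lemma geometricM s m : (2 ^ s).-1 * geometric s m = (2 ^ (s * m)).-1.
Proof.
rewrite expnM (predn_exp (2 ^ s)); congr (_ * _).
by apply: eq_bigr => i _; rewrite expnM.
Qed.

(** The geometric sum is the quotient of [2 ^ (s * m) - 1] by [2 ^ s - 1], so the product is an
    exact quotient of [Y * 2 ^ t - Y]. Since multiplication is not an operation, the exponent [t] is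
    supplied separately. *)
Lemma definable_mul_geometric Y s m t : (forall p, 0 < s p) ->
  (forall p, t p = s p * m p) -> definable Y -> definable s -> definable t ->
  definable (fun p => Y p * geometric (s p) (m p)).
Proof.
move=> s0 tE dY ds dt; have := definable_shl dY dt.
have pos p : 0 < (2 ^ s p).-1.
  by rewrite -subn1 subn_gt0 -{1}(expn0 2) ltn_exp2l.
have numE p : Y p * 2 ^ t p - Y p = Y p * geometric (s p) (m p) * (2 ^ s p).-1.
  by rewrite tE -mulnA [geometric _ _ * _]mulnC geometricM -subn1 mulnBr muln1.
move/definable_sub/(_ dY) => dnum.
have {}dnum : definable (fun p => Y p * 2 ^ t p - Y p).
  by apply: dnum => p; rewrite leq_pmulr ?expn_gt0.
apply: definable_ext (definable_div pos _ dnum (definable_pred_pow2 ds)) => p.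
  by rewrite numE mulnK.
by rewrite numE dvdn_mull.
Qed.

(** * Packed tables *)

(** This exponent makes the input smaller than [2 ^ scale p] and grows with the assisting number. *)
Definition scale (p : nat * nat) : nat := p.1 + p.2.

(** The number of bits of a table in [k] variables: [2 ^ (M * k)] fields of [2 ^ M] bits. *)
Definition width (M k : nat) : nat := 2 ^ (M * k.+1).

(* [table M k F] packs the values [F s], for the sequences [s] of [k] numbers
   below [2 ^ M], into fields of [width M 0 = 2 ^ M] bits; the last entry of [s]
   is the most significant digit of the position of the field. *)
Fixpoint table (M k : nat) (F : seq nat -> nat) : nat :=
  if k is k'.+1 then
    \sum_(a < 2 ^ M) table M k' (fun s => F (rcons s a)) * 2 ^ (width M k' * a)
  else F [::].

Definition in_range (M k : nat) (s : seq nat) : bool :=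
  (size s == k) && all (fun a => a < 2 ^ M) s.

Lemma in_range_rcons M k s a :
  in_range M k s -> a < 2 ^ M -> in_range M k.+1 (rcons s a).
Proof. by rewrite /in_range size_rcons eqSS all_rcons => /andP[-> ->] ->. Qed.

Lemma widthS M k : width M k.+1 = width M k * 2 ^ M.
Proof. by rewrite /width -expnD mulnS addnC. Qed.

Lemma width_gt0 M k : 0 < width M k.
Proof. by rewrite expn_gt0. Qed.

Lemma eq_table M k F G :
  (forall s, in_range M k s -> F s = G s) -> table M k F = table M k G.
Proof.
elim: k F G => [|k IHk] F G eqFG /=; first exact: eqFG.
apply: eq_bigr => a _; congr (_ * _); apply: IHk => s rs.
by apply: eqFG; apply: in_range_rcons.
Qed.

Definition blocks (w m : nat) (f : nat -> nat) : nat :=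
  \sum_(a < m) f a * 2 ^ (w * a).

Lemma blocks_lt w m f : (forall a, a < m -> f a < 2 ^ w) ->
  blocks w m f < 2 ^ (w * m).
Proof.
elim: m => [|m IHm] ltf; first by rewrite /blocks big_ord0 muln0.
rewrite /blocks big_ord_recr mulnS expnD /= -/(blocks _ _ _).
have /IHm lt : forall a, a < m -> f a < 2 ^ w by move=> a lta; apply/ltf/ltnW.
apply: leq_trans (_ : (f m).+1 * 2 ^ (w * m) <= _); last first.
  by rewrite leq_mul2r ltf ?orbT.
by rewrite mulSn -addSn leq_add2r.
Qed.

Lemma table_lt M k F : (forall s, in_range M k s -> F s < 2 ^ 2 ^ M) ->
  table M k F < 2 ^ width M k.
Proof.
elim: k F => [|k IHk] F ltF /=.
  by rewrite /width muln1; apply: ltF.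
rewrite widthS; apply: (@blocks_lt _ _ (fun a => table M k (fun s => F (rcons s a)))).
by move=> a lta; apply: IHk => s rs; apply/ltF/in_range_rcons.
Qed.

Lemma blocks_bitwise2 beta w m f g : beta false false = false ->
  (forall a, a < m -> f a < 2 ^ w) -> (forall a, a < m -> g a < 2 ^ w) ->
  bitwise2 beta (blocks w m f) (blocks w m g) =
  blocks w m (fun a => bitwise2 beta (f a) (g a)).
Proof.
move=> beta0; elim: m => [|m IHm] ltf ltg.
  rewrite /blocks !big_ord0; apply: bit_inj => i.
  by rewrite bit_bitwise2 // bit0n.
have ltf' a : a < m -> f a < 2 ^ w by move=> lta; apply/ltf/ltnW.
have ltg' a : a < m -> g a < 2 ^ w by move=> lta; apply/ltg/ltnW.
rewrite /blocks !big_ord_recr /= -!/(blocks _ _ _).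
by rewrite bitwise2_split ?blocks_lt // IHm.
Qed.

Lemma table_bitwise2 beta M k F G : beta false false = false ->
  (forall s, in_range M k s -> F s < 2 ^ 2 ^ M) ->
  (forall s, in_range M k s -> G s < 2 ^ 2 ^ M) ->
  bitwise2 beta (table M k F) (table M k G) =
  table M k (fun s => bitwise2 beta (F s) (G s)).
Proof.
move=> beta0; elim: k F G => [|k IHk] F G ltF ltG //=.
rewrite -!/(blocks _ _ (fun a => table M k (fun s => _ (rcons s a)))).
have lt H a : (forall s, in_range M k.+1 s -> H s < 2 ^ 2 ^ M) -> a < 2 ^ M ->
    table M k (fun s => H (rcons s a)) < 2 ^ width M k.
  by move=> ltH lta; apply: table_lt => s rs; apply/ltH/in_range_rcons.
rewrite blocks_bitwise2 // => [|a|a]; [|exact: lt|exact: lt].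
apply: eq_bigr => a _; rewrite IHk // => s rs.
  exact/ltF/in_range_rcons.
exact/ltG/in_range_rcons.
Qed.

Lemma table_add M k F G :
  table M k F + table M k G = table M k (fun s => F s + G s).
Proof.
elim: k F G => [|k IHk] F G //=.
by rewrite -big_split /=; apply: eq_bigr => a _; rewrite -mulnDl IHk.
Qed.

Lemma table_mulr M k F c : table M k F * c = table M k (fun s => F s * c).
Proof.
elim: k F => [|k IHk] F //=.
by rewrite big_distrl /=; apply: eq_bigr => a _; rewrite mulnAC IHk.
Qed.

Lemma table_sub M k F G : (forall s, in_range M k s -> G s <= F s) ->
  table M k F - table M k G = table M k (fun s => F s - G s).
Proof.
move=> leGF; rewrite -[RHS](addnK (table M k G)) table_add.
by congr (_ - _); apply: eq_table => s rs; rewrite subnK ?leGF.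
Qed.

Lemma table_le M k F G : (forall s, in_range M k s -> G s <= F s) ->
  table M k G <= table M k F.
Proof.
move=> leGF; rewrite (_ : table M k F = table M k (fun s => F s - G s) + table M k G).
  exact: leq_addl.
by rewrite table_add; apply: eq_table => s rs; rewrite subnK ?leGF.
Qed.

Lemma table_sum M k m (F : nat -> seq nat -> nat) :
  \sum_(a < m) table M k (F a) = table M k (fun s => \sum_(a < m) F a s).
Proof.
elim: m => [|m IHm].
  rewrite big_ord0; apply/esym; apply: etrans (_ : table M k (fun=> 0 * 0) = 0).
    by apply: eq_table => s _; rewrite big_ord0.
  by rewrite -(table_mulr _ _ (fun=> 0)) muln0.
rewrite big_ord_recr /= IHm table_add.
by apply: eq_table => s _; rewrite big_ord_recr.
Qed.

(** * Tables computable in constant time *)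

Definition tabulable (k : nat) (F : nat -> seq nat -> nat) : Prop :=
  definable (fun p => table (scale p) k (F (scale p))).

Lemma eq_tabulable k F G :
  (forall M s, in_range M k s -> F M s = G M s) -> tabulable k F -> tabulable k G.
Proof. by move=> eqFG; apply: definable_ext => p; apply: eq_table => s /eqFG. Qed.

Lemma tabulable_add k F G : tabulable k F -> tabulable k G ->
  tabulable k (fun M s => F M s + G M s).
Proof.
move=> tF tG; apply: definable_ext (definable_add tF tG) => p.
exact: table_add.
Qed.

Lemma tabulable_sub k F G : (forall M s, in_range M k s -> G M s <= F M s) ->
  tabulable k F -> tabulable k G -> tabulable k (fun M s => F M s - G M s).
Proof.
move=> leGF tF tG; apply: definable_ext (definable_sub _ tF tG) => p.
  by apply: table_sub => s /leGF.
by apply: table_le => s /leGF.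
Qed.

Definition fits k (F : nat -> seq nat -> nat) : Prop :=
  forall M s, in_range M k s -> F M s < 2 ^ 2 ^ M.

Lemma tabulable_land k F G : fits k F -> fits k G ->
  tabulable k F -> tabulable k G -> tabulable k (fun M s => land (F M s) (G M s)).
Proof.
move=> fF fG tF tG; apply: definable_ext (definable_bitwise2 andb tF tG) => p.
by apply: table_bitwise2 => // s; [apply: fF | apply: fG].
Qed.

Lemma definable_scale : definable scale.
Proof. exact: definable_add definable_fst definable_snd. Qed.

Lemma definable_scale_mul k : definable (fun p => scale p * k).
Proof.
elim: k => [|k IHk].
  by apply: definable_ext (definable_bool false) => p; rewrite muln0.
apply: definable_ext (definable_add definable_scale IHk) => p.
by rewrite mulnS.
Qed.

Lemma definable_width k : definable (fun p => width (scale p) k).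
Proof. exact/definable_pow2/definable_scale_mul. Qed.

(** A table that ignores its last variable consists of [2 ^ M] equal blocks, and a geometric sum
    makes these copies. *)
Lemma tabulable_lift k F : tabulable k F ->
  tabulable k.+1 (fun M s => F M (take k s)).
Proof.
move=> tF; have := definable_mul_geometric (fun p => width_gt0 (scale p) k)
  (fun p => widthS (scale p) k) tF (definable_width k) (definable_width k.+1).
apply: definable_ext => p /=; rewrite /geometric big_distrr /=.
apply: eq_bigr => a _; congr (_ * _); apply: eq_table => s /andP[/eqP<- _].
by rewrite -cats1 take_size_cat.
Qed.

Lemma tabulable_cst (c : nat -> nat) k : definable (fun p => c (scale p)) ->
  tabulable k (fun M _ => c M).
Proof. by move=> dc; elim: k => [|k IHk] //; apply: tabulable_lift IHk. Qed.

(** The essential case is the last variable, [i = k]: block [a] holds [a] in every field, so the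
    table is [Y] times the sum of the [a * X ^ a], with [Y] the table of ones and [X] the weight of
    a block. *)
Lemma tabulable_nth k i : tabulable k (fun _ s => nth 0 s i).
Proof.
elim: k => [|k IHk].
  by apply: definable_ext (definable_bool false) => p; rewrite /= nth_nil.
have [ltik|] := ltnP i k.
  apply: eq_tabulable (tabulable_lift IHk) => M s _; exact: nth_take.
rewrite leq_eqVlt => /predU1P[<-|ltki]; last first.
  have := @tabulable_cst (fun=> 0) k.+1 (definable_bool false); apply: eq_tabulable => M s.
  by case/andP=> /eqP sz _; rewrite nth_default ?sz.
have t1 : tabulable k (fun=> fun=> 1) := @tabulable_cst (fun=> 1) k (definable_bool true).
pose X p := 2 ^ width (scale p) k.
pose Y p := table (scale p) k (fun=> 1).
pose G p := Y p * geometric (width (scale p) k) (2 ^ scale p).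
have dw := definable_width k; have dw' := definable_width k.+1.
have dG : definable G.
  by apply: definable_mul_geometric t1 dw dw' => p; rewrite ?width_gt0 ?widthS.
have pos p : 0 < (X p).-1.
  by rewrite -subn1 subn_gt0 -{1}(expn0 2) ltn_exp2l // width_gt0.
pose V p := table (scale p) k.+1 (fun s => nth 0 s k).
have VE p : V p = Y p * \sum_(a < 2 ^ scale p) a * X p ^ a.
  rewrite /V /= big_distrr; apply: eq_bigr => a _ /=.
  rewrite [RHS]mulnA [Y p * a]table_mulr /X -expnM; congr muln; apply: eq_table => s.
  by case/andP=> /eqP<- _; rewrite nth_rcons ltnn eqxx mul1n.
(* Summation by parts leaves a geometric sum and the term [m * x ^ m], which is obtained by shifts
   because [m] and [x] will be powers of two. *)
have sumE x m : 0 < x -> x.-1 * (\sum_(a < m) a * x ^ a) + x * \sum_(a < m) x ^ a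
    = m * x ^ m.
  case: x => // x _; elim: m => [|m IHm]; first by rewrite !big_ord0 !muln0.
  rewrite !big_ord_recr /= !mulnDr addnACA IHm expnS; nia.
have numE p : Y p * 2 ^ scale p * 2 ^ width (scale p) k.+1 - G p * X p = V p * (X p).-1.
  rewrite VE /G /geometric (eq_bigr (fun a : 'I_ _ => X p ^ a)); last first.
    by move=> a _; rewrite expnM.
  rewrite widthS expnM -/(X p) -!mulnA -(sumE (X p)) ?expn_gt0 //.
  by rewrite -mulnBr [_ * X p]mulnC addnK [_.-1 * _]mulnC.
have dnum : definable
    (fun p => Y p * 2 ^ scale p * 2 ^ width (scale p) k.+1 - G p * X p).
  apply: definable_sub => [p||].
  - rewrite /G /geometric (eq_bigr (fun a : 'I_ _ => X p ^ a)); last first.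
      by move=> a _; rewrite expnM.
    rewrite widthS expnM -/(X p) -!mulnA -(sumE (X p)) ?expn_gt0 //.
    by rewrite leq_mul2l [_ * X p]mulnC leq_addl orbT.
  - exact: definable_shl (definable_shl t1 definable_scale) dw'.
  - exact: definable_shl dG dw.
apply: definable_ext (definable_div pos _ dnum (definable_pred_pow2 dw)) => p.
  by rewrite numE mulnK.
by rewrite numE dvdn_mull.
Qed.

(** For the last variable, block [a] carries the factor [2 ^ a] besides its weight [2 ^ (w * a)]:
    again a geometric sum, with ratio [2 ^ (w + 1)]. A variable out of range reads 0 and gives 1. *)
Lemma tabulable_pow2_nth k i : tabulable k (fun _ s => 2 ^ nth 0 s i).
Proof.
have t1 n : tabulable n (fun=> fun=> 1) := @tabulable_cst (fun=> 1) n (definable_bool true).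
elim: k => [|k IHk].
  by apply: definable_ext (definable_bool true) => p; rewrite /= nth_nil.
have [ltik|] := ltnP i k.
  by apply: eq_tabulable (tabulable_lift IHk) => M s _; rewrite nth_take.
rewrite leq_eqVlt => /predU1P[<-|ltki]; last first.
  apply: eq_tabulable (t1 k.+1) => M s.
  by case/andP=> /eqP sz _; rewrite nth_default ?sz.
pose s p := width (scale p) k + 1.
pose t p := width (scale p) k.+1 + 2 ^ scale p.
have dw := definable_width k; have dw' := definable_width k.+1.
have ds : definable s by apply: definable_add dw (definable_bool true).
have dt : definable t by apply: definable_add dw' (definable_pow2 definable_scale).
have := @definable_mul_geometric _ s (fun p => 2 ^ scale p) t _ _ (t1 k) ds dt.
move=> dG; apply: definable_ext (dG _ _) => p; last 2 first.
- by rewrite /s addn1.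
- by rewrite /s /t widthS mulnDl mul1n.
rewrite /= /geometric big_distrr; apply: eq_bigr => a _ /=.
rewrite /s mulnDl expnD mul1n [_ ^ _ * _ ^ a]mulnC mulnA table_mulr; congr (_ * _).
by apply: eq_table => u /andP[/eqP<- _]; rewrite nth_rcons ltnn eqxx mul1n.
Qed.

(** The weight of the top bit of a field, which will serve as a flag for comparisons. *)
Definition half_field (M : nat) : nat := 2 ^ (2 ^ M).-1.

Lemma half_fieldM2 M : 2 ^ 2 ^ M = 2 * half_field M.
Proof. by rewrite -expnS prednK // expn_gt0. Qed.

Lemma half_field_gt0 M : 0 < half_field M.
Proof. by rewrite expn_gt0. Qed.

Lemma leq_half_field M : 2 ^ M <= half_field M.
Proof. by rewrite leq_exp2l // -ltnS prednK ?expn_gt0 // ltn_expl. Qed.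

Lemma definable_half_field : definable (fun p => half_field (scale p)).
Proof. exact/definable_pow2/definable_pred_pow2/definable_scale. Qed.

(** Masking leaves only the flag in each field; an exact division by its weight moves all flags to
    the lowest bits at once. *)
Lemma tabulable_threshold k F : fits k F -> tabulable k F ->
  tabulable k (fun M s => half_field M <= F M s).
Proof.
move=> fF tF.
have th : tabulable k (fun M _ => half_field M).
  exact/tabulable_cst/definable_half_field.
have fh : fits k (fun M _ => half_field M).
  by move=> M s _; rewrite half_fieldM2; have := half_field_gt0 M; lia.
have := definable_div _ _ (tabulable_land fF fh tF th) definable_half_field.
have tE p : table (scale p) k (fun s => land (F (scale p) s) (half_field (scale p)))
   = table (scale p) k (fun s => half_field (scale p) <= F (scale p) s) *
     half_field (scale p).
  rewrite table_mulr; apply: eq_table => s rs; rewrite land_pow2 //.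
  by rewrite prednK ?expn_gt0 // fF.
move=> dF; apply: definable_ext (dF _ _) => p; rewrite ?half_field_gt0 //.
  by rewrite tE mulnK // half_field_gt0.
by rewrite tE dvdn_mull.
Qed.

(** Adding [half_field M - 1] raises the flag exactly in the positive fields, and the bound on [F]
    prevents overflow. *)
Lemma tabulable_nonzero k F :
  (forall M s, in_range M k s -> F M s <= half_field M) -> tabulable k F ->
  tabulable k (fun M s => 0 < F M s).
Proof.
move=> leF tF.
have tc : tabulable k (fun M _ => half_field M - 1).
  apply/tabulable_cst/definable_sub; last exact: definable_bool true.
    by move=> p; apply: half_field_gt0.
  exact: definable_half_field.
apply: eq_tabulable (tabulable_threshold _ (tabulable_add tF tc)) => M s rs /=.
  congr nat_of_bool; have := half_field_gt0 M; lia.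
by rewrite half_fieldM2; have := half_field_gt0 M; have := leF M s rs; lia.
Qed.

Lemma nth_in_range M k s i : in_range M k s -> nth 0 s i < 2 ^ M.
Proof.
case/andP=> _ /allP lts; have [lti|gei] := ltnP i (size s).
  exact/lts/mem_nth.
by rewrite nth_default ?expn_gt0.
Qed.

(** The flag of [half_field M - 1 - s_i + s_j] is raised exactly when [s_i < s_j]. *)
Lemma tabulable_ltn k i j : tabulable k (fun _ s => nth 0 s i < nth 0 s j).
Proof.
have tc : tabulable k (fun M _ => half_field M - 1).
  apply/tabulable_cst/definable_sub; last exact: definable_bool true.
    by move=> p; apply: half_field_gt0.
  exact: definable_half_field.
have bound M s l : in_range M k s -> nth 0 s l < half_field M.
  by move=> /(nth_in_range l) lt; apply: leq_trans lt (leq_half_field M).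
have ts := tabulable_sub _ tc (tabulable_nth k i).
have ta := tabulable_add (ts _) (tabulable_nth k j).
apply: eq_tabulable (tabulable_threshold _ (ta _)) => M s rs /=.
- by congr nat_of_bool; have := bound M s i rs; have := bound M s j rs; lia.
- rewrite half_fieldM2.
  by have := bound M s i rs; have := bound M s j rs; lia.
- by have := bound M s i rs; lia.
Qed.

Lemma land_pow2_gt0 a i : (0 < land a (2 ^ i)) = bit a i.
Proof.
apply/idP/idP => [|ai].
  apply: contraLR => /negbTE nai; rewrite -leqNgt leqn0; apply/eqP.
  apply: bit_inj => j; rewrite bit_bitwise2 // bit_pow2 bit0n.
  by case: eqP => [->|]; rewrite ?nai ?andbF.
rewrite lt0n; apply: contraTneq ai => a0.
have := bit_bitwise2 a (2 ^ i) i (erefl (false && false)).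
by rewrite -/(land _ _) a0 bit0n bit_pow2 eqxx andbT => <-.
Qed.

(** Here [s_j] is masked by [2 ^ s_i], which fits because [s_i] is below the number [2 ^ M] of bits
    of a field. *)
Lemma tabulable_bit k i j : tabulable k (fun _ s => bit (nth 0 s j) (nth 0 s i)).
Proof.
have lt2 M s l : in_range M k s -> nth 0 s l < 2 ^ M by apply: nth_in_range.
have fj : fits k (fun _ s => nth 0 s j).
  by move=> M s rs; apply: ltn_trans (lt2 M s j rs) (ltn_expl _ _).
have fi : fits k (fun _ s => 2 ^ nth 0 s i).
  by move=> M s rs; rewrite ltn_exp2l // lt2.
have tl := tabulable_land fj fi (tabulable_nth k j) (tabulable_pow2_nth k i).
apply: eq_tabulable (tabulable_nonzero _ tl) => M s rs; first by rewrite land_pow2_gt0.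
by apply: leq_trans (leq_half_field M); apply/ltnW/land_lt/lt2.
Qed.

Lemma fits_bool k (R : nat -> seq nat -> bool) : fits k R.
Proof.
move=> M s _; apply: leq_ltn_trans (leq_b1 _) _.
by rewrite -{1}(expn0 2) ltn_exp2l // expn_gt0.
Qed.

Lemma land_bool (a b : bool) : land a b = a && b.
Proof.
apply: bit_inj => i; rewrite bit_bitwise2 // !bit_bool.
by case: (i == 0).
Qed.

Lemma tabulable_andb k (R Q : nat -> seq nat -> bool) :
  tabulable k R -> tabulable k Q -> tabulable k (fun M s => R M s && Q M s).
Proof.
move=> tR tQ.
apply: eq_tabulable (tabulable_land (fits_bool R) (fits_bool Q) tR tQ) => M s _.
exact: land_bool.
Qed.

Lemma tabulable_negb k (R : nat -> seq nat -> bool) :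
  tabulable k R -> tabulable k (fun M s => ~~ R M s).
Proof.
have t1 := @tabulable_cst (fun=> 1) k (definable_bool true).
move=> tR; apply: eq_tabulable (tabulable_sub _ t1 tR) => M s _.
  by case: (R M s).
exact: leq_b1.
Qed.

(* Multiplying [sum_a Z_a X^a] by [sum_(b <= u) X^b] puts the sum of all the
   [Z_a] in the block of weight [X^u], without any carry from the lower ones. *)
Lemma middle_block w u (Z : nat -> nat) : 0 < w ->
  \sum_(a < u.+1) Z a < 2 ^ w ->
  land (blocks w u.+1 Z * geometric w u.+1) ((2 ^ w).-1 * 2 ^ (w * u)) =
  (\sum_(a < u.+1) Z a) * 2 ^ (w * u).
Proof.
move=> w0; set X := 2 ^ w; set S := \sum_(a < _) _ => ltSX.
have geoE m n : geometric w (m + n) = geometric w m + 2 ^ (w * m) * geometric w n.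
  rewrite /geometric big_split_ord /= big_distrr /=; congr (_ + _).
  by apply: eq_bigr => i _; rewrite mulnDr expnD.
(* Of the [u.+1] copies of [Z a], [u - a] land below block [u] and are collected in [L], one lands
   on it, and [a] land above it and are collected in [H]. *)
pose L := \sum_(a < u.+1) Z a * 2 ^ (w * a) * geometric w (u - a).
pose H := \sum_(a < u.+1) Z a * geometric w a.
have -> : blocks w u.+1 Z * geometric w u.+1 = L + (S + H * X) * 2 ^ (w * u).
  rewrite /blocks /L /S /H mulnDl !big_distrl -!big_split /=.
  apply: eq_bigr => a _.
  have uE : u.+1 = (u - a) + (1 + a) by have := ltn_ord a; lia.
  have -> : geometric w u.+1 =
      geometric w (u - a) + 2 ^ (w * (u - a)) * (1 + X * geometric w a).
    by rewrite {1}uE !geoE {2}/geometric big_ord1 muln0 expn0 muln1.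
  have -> : 2 ^ (w * u) = 2 ^ (w * a) * 2 ^ (w * (u - a)).
    by rewrite -expnD -mulnDr subnKC // -ltnS.
  ring.
(* After multiplication by [X - 1] each geometric sum telescopes, so [(X - 1) * L] is at most
   [S * (X ^ u - 1)], while [S] is at most [X - 1]. *)
have ltL : L < 2 ^ (w * u).
  have X1 : 0 < X.-1.
    by rewrite -subn1 subn_gt0 -{1}(expn0 2) ltn_exp2l.
  have S1 : S <= X.-1 by rewrite -ltnS prednK ?expn_gt0.
  rewrite -[ltnRHS]prednK ?expn_gt0 // ltnS -(leq_pmul2l X1).
  apply: leq_trans (_ : S * (2 ^ (w * u)).-1 <= _); last by rewrite leq_mul2r S1 orbT.
  rewrite /L /S big_distrl big_distrr leq_sum //= => a _.
  rewrite mulnCA geometricM -mulnA leq_mul2l; apply/orP; right.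
  have -> : 2 ^ (w * u) = 2 ^ (w * a) * 2 ^ (w * (u - a)).
    by rewrite -expnD -mulnDr subnKC // -ltnS.
  by rewrite -!subn1 mulnBr muln1 leq_sub2l // expn_gt0.
rewrite -[X in land _ X]add0n /land bitwise2_split ?expn_gt0 //.
rewrite -!/(land _ _) land0r add0n; congr muln.
rewrite -[X.-1]addn0 -(mul0n X) /land bitwise2_split //; last by rewrite prednK ?expn_gt0.
by rewrite -!/(land _ _) land0r mul0n addn0 land_pred_pow2.
Qed.

(** Adding the blocks of the last variable counts the witnesses in each field. The count is at most
    [2 ^ M], hence fits, and is then tested against zero. *)
Lemma tabulable_exists k (R : nat -> seq nat -> bool) :
  tabulable k.+1 R ->
  tabulable k (fun M s => has (fun a => R M (rcons s a)) (iota 0 (2 ^ M))).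
Proof.
move=> tR.
pose F M (s : seq nat) := \sum_(a < 2 ^ M) R M (rcons s a).
have leF M s : F M s <= 2 ^ M.
  rewrite -[leqRHS]card_ord -sum1_card; apply: leq_sum => a _; exact: leq_b1.
have ltF M s : F M s < 2 ^ 2 ^ M by apply: leq_ltn_trans (leF M s) (ltn_expl _ _).
have dw := definable_width k; have dw' := definable_width k.+1.
(* The position of block [u = 2 ^ M - 1], where the blocks add up, is a difference of two widths. *)
have dsh : definable (fun p => width (scale p) k * (2 ^ scale p).-1).
  apply: definable_ext (definable_sub _ dw' dw) => p; rewrite widthS.
    by rewrite -subn1 mulnBr muln1.
  by rewrite leq_pmulr ?expn_gt0.
have dP := definable_mul_geometric (fun p => width_gt0 (scale p) k)
  (fun p => widthS (scale p) k) tR dw dw'.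
have dm := definable_shl (definable_pred_pow2 dw) dsh.
have tE p : land (table (scale p) k.+1 (R (scale p)) *
    geometric (width (scale p) k) (2 ^ scale p))
    ((2 ^ width (scale p) k).-1 * 2 ^ (width (scale p) k * (2 ^ scale p).-1)) =
    table (scale p) k (F (scale p)) * 2 ^ (width (scale p) k * (2 ^ scale p).-1).
  have [u uE] : exists u, 2 ^ scale p = u.+1.
    by exists (2 ^ scale p).-1; rewrite prednK ?expn_gt0.
  have FE : \sum_(a < u.+1)
      table (scale p) k (fun s => R (scale p) (rcons s a)) =
      table (scale p) k (F (scale p)).
    rewrite (table_sum _ _ _ (fun a s => R (scale p) (rcons s a))).
    by apply: eq_table => s _; rewrite /F uE.
  rewrite -FE [table _ k.+1 _]/= uE /=.
  rewrite -/(blocks _ _ (fun a => table (scale p) k (fun s => R (scale p) (rcons s a)))).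
  by rewrite middle_block ?width_gt0 // FE table_lt.
have tF : tabulable k F.
  apply: definable_ext (definable_div _ _ (definable_bitwise2 andb dP dm)
    (definable_pow2 dsh)) => p; rewrite -?/(land _ _) ?tE.
  - by rewrite mulnK // expn_gt0.
  - by rewrite expn_gt0.
  - exact: dvdn_mull.
apply: eq_tabulable (tabulable_nonzero _ tF) => M s _; last first.
  exact: leq_trans (leF M s) (leq_half_field M).
congr nat_of_bool; apply/idP/hasP => [|[a]].
  rewrite lt0n sum_nat_eq0 => /forallPn[a]; rewrite eqb0 negbK => Ra.
  by exists (a : nat) => //; rewrite mem_iota ltn_ord.
rewrite mem_iota => /andP[_ lta] Ra; rewrite lt0n sum_nat_eq0; apply/forallPn.
by exists (Ordinal lta); rewrite /= Ra.
Qed.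

(** * Formulas and recursive functions *)

Inductive formula :=
  | Lt (i j : nat)
  | In (i j : nat)
  | And (A B : formula)
  | Not (A : formula)
  | Ex (A : formula).

(* Variables are de Bruijn levels, quantifiers range over the numbers below
   [2 ^ M], and [In] is Ackermann's membership: [i] is in [j] when the bit of
   weight [2 ^ i] of [j] is set. *)
Fixpoint holds (M : nat) (A : formula) (s : seq nat) : bool :=
  match A with
  | Lt i j => nth 0 s i < nth 0 s j
  | In i j => bit (nth 0 s j) (nth 0 s i)
  | And A B => holds M A s && holds M B s
  | Not A => ~~ holds M A s
  | Ex A => has (fun a => holds M A (rcons s a)) (iota 0 (2 ^ M))
  end.

Lemma tabulable_holds A k : tabulable k (fun M => holds M A).
Proof.
elim: A k => [i j|i j|A IHA B IHB|A IHA|A IHA] k /=.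
- exact: tabulable_ltn.
- exact: tabulable_bit.
- exact: tabulable_andb.
- exact: tabulable_negb.
- exact: (tabulable_exists (R := fun M => holds M A)).
Qed.

(** The answer is field number [p.1] of the truth table in one variable; a mask isolates it and an
    exact division shifts it down. *)
Lemma definable_holds A : definable (fun p => holds (scale p) A [:: p.1]).
Proof.
have dM := definable_scale.
have dsh := definable_shl definable_fst dM.
have dT := tabulable_holds A 1.
have db := definable_pow2 dsh.
have tE p : land (table (scale p) 1 (holds (scale p) A)) (2 ^ (p.1 * 2 ^ scale p))
    = holds (scale p) A [:: p.1] * 2 ^ (p.1 * 2 ^ scale p).
  have lt : p.1 < 2 ^ scale p.
    by apply: leq_ltn_trans (leq_addr p.2 p.1) (ltn_expl _ _).
  have wE : width (scale p) 0 = 2 ^ scale p by rewrite /width muln1.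
  (* The mask is itself the table of the indicator of [p.1], so masking is a fieldwise
     conjunction. *)
  have oneE R : table (scale p) 1 (fun s => R s && (nth 0 s 0 == p.1)) =
      R [:: p.1] * 2 ^ (p.1 * 2 ^ scale p).
    rewrite /= (bigD1 (Ordinal lt)) //= eqxx andbT wE mulnC [p.1 * _]mulnC.
    rewrite big1 ?addn0 1?mulnC // => a; rewrite -val_eqE /= => /negbTE->.
    by rewrite andbF.
  rewrite -[X in land _ X]mul1n -(oneE xpredT) -oneE.
  have fitb (R : seq nat -> bool) s : in_range (scale p) 1 s -> R s < 2 ^ 2 ^ scale p.
    exact: (fits_bool (fun=> R)).
  rewrite /land table_bitwise2 //; [|exact: fitb|exact: fitb].
  by apply: eq_table => s _; rewrite -/(land _ _) land_bool.
apply: definable_ext (definable_div _ _ (definable_bitwise2 andb dT db) db) => p;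
  rewrite -?/(land _ _) ?tE.
- by rewrite mulnK // expn_gt0.
- by rewrite expn_gt0.
- exact: dvdn_mull.
Qed.

(** Ackermann's code of the set [{a, b}]; disjunction instead of addition also covers [a = b]. *)
Definition upair (a b : nat) : nat := bitwise2 orb (2 ^ a) (2 ^ b).

Lemma bit_upair a b i : bit (upair a b) i = (i == a) || (i == b).
Proof. by rewrite bit_bitwise2 // !bit_pow2. Qed.

Lemma upair_inj a b c d :
  upair a b = upair c d -> a = c /\ b = d \/ a = d /\ b = c.
Proof.
move=> eq2; have eqb i : (i == a) || (i == b) = (i == c) || (i == d).
  by rewrite -!bit_upair eq2.
have := eqb a; have := eqb b; have := eqb c; have := eqb d; rewrite !eqxx; lia.
Qed.

(** Kuratowski's ordered pair. *)
Definition opair (a b : nat) : nat := upair (upair a a) (upair a b).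

Lemma opair_inj a b c d : opair a b = opair c d -> a = c /\ b = d.
Proof. by case/upair_inj => -[/upair_inj eq1 /upair_inj eq2]; lia. Qed.

(** * Defined formulas and variable contexts *)

Definition Or A B := Not (And (Not A) (Not B)).
Definition Imp A B := Not (And A (Not B)).
Definition All A := Not (Ex (Not A)).
Definition Eq i j := And (Not (Lt i j)) (Not (Lt j i)).
(** Here and below, [k] is the length of the context, hence the level of the next bound variable. *)
Definition IsZero (k i : nat) := Not (Ex (Lt k i)).
Definition IsSucc (k i j : nat) := And (Lt i j) (Not (Ex (And (Lt i k) (Lt k j)))).
Definition IsUPair (k e i j : nat) :=
  All (And (Imp (In k e) (Or (Eq k i) (Eq k j)))
           (Imp (Or (Eq k i) (Eq k j)) (In k e))).
Definition IsOPair (k p i j : nat) :=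
  Ex (Ex (And (And (IsUPair k.+2 k i i) (IsUPair k.+2 k.+1 i j))
              (IsUPair k.+2 p k k.+1))).

(** The bound on [i] excludes the default value of [nth], so the value survives extensions of the
    context. *)
Definition valued (s : seq nat) (i a : nat) := i < size s /\ nth 0 s i = a.

Lemma valued_rcons s i a b : valued s i a -> valued (rcons s b) i a.
Proof. by move=> [lti eqa]; rewrite /valued size_rcons nth_rcons lti ltnS ltnW. Qed.

Lemma valued_last M k s a : in_range M k s -> valued (rcons s a) k a.
Proof.
by case/andP=> /eqP<- _; rewrite /valued size_rcons nth_rcons ltnn eqxx.
Qed.

Lemma valued_lt M k s i a : in_range M k s -> valued s i a -> a < 2 ^ M.
Proof. by move=> rs [_ <-]; apply: nth_in_range rs. Qed.

Definition all_valued (s : seq nat) (vs v : seq nat) :=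
  all (fun i => i < size s) vs /\ [seq nth 0 s i | i <- vs] = v.

Lemma all_valued_cat s t vs v : all_valued s vs v -> all_valued (s ++ t) vs v.
Proof.
move=> [lts <-]; split.
  by apply: sub_all lts => i lti; rewrite size_cat ltn_addr.
by apply/eq_in_map => i /(allP lts) lti; rewrite nth_cat lti.
Qed.

Lemma all_valued_rcons s b vs v : all_valued s vs v -> all_valued (rcons s b) vs v.
Proof. by rewrite -cats1; apply: all_valued_cat. Qed.

Lemma all_valued_cons s i vs a v :
  valued s i a -> all_valued s vs v -> all_valued s (i :: vs) (a :: v).
Proof. by move=> [lti eqa] [lts eqv]; split=> /=; rewrite ?lti ?eqa ?eqv. Qed.

Lemma all_valued_nth s vs v i :
  all_valued s vs v -> i < size vs -> valued s (nth 0 vs i) (nth 0 v i).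
Proof.
move=> [lts <-] lti; split; first exact: all_nthP lts _ lti.
by rewrite (nth_map 0).
Qed.

Lemma all_valued_behead s vs v :
  all_valued s vs v -> all_valued s (behead vs) (behead v).
Proof. by case: vs => [|i vs] [] //= => [_ <-|/andP[_ lts] <-]. Qed.

Ltac solve_in_range :=
  first [eassumption | simple eapply in_range_rcons; [solve_in_range | assumption]].

Ltac solve_valued :=
  first [ eassumption
        | simple eapply valued_last; solve_in_range
        | simple apply valued_rcons; solve_valued ].

Ltac solve_all_valued :=
  first [ eassumption
        | simple apply all_valued_cons; [solve_valued | solve_all_valued]
        | simple apply all_valued_rcons; solve_all_valued
        | simple apply all_valued_behead; solve_all_valued ].

Ltac solve_context := first [solve_in_range | solve_valued | solve_all_valued].

(** With the congruence rules that follow, formulas are translated one connective at a time, keeping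
    the bounds at hand. *)
Lemma ex_bounded_iff (U : nat) (P Q : nat -> Prop) :
  (forall a, a < U -> P a <-> Q a) ->
  (exists a, a < U /\ P a) <-> (exists a, a < U /\ Q a).
Proof.
by move=> PQ; split=> -[a [lta]] /(PQ a lta) ?; exists a.
Qed.

Lemma all_bounded_iff (U : nat) (P Q : nat -> Prop) :
  (forall a, a < U -> P a <-> Q a) ->
  (forall a, a < U -> P a) <-> (forall a, a < U -> Q a).
Proof.
by move=> PQ; split=> Pa a lta; apply/(PQ a lta)/Pa.
Qed.

Lemma and_iff (A B C D : Prop) : (A <-> B) -> (C <-> D) -> (A /\ C <-> B /\ D).
Proof. tauto. Qed.

Lemma or_iff (A B C D : Prop) : (A <-> B) -> (C <-> D) -> (A \/ C <-> B \/ D).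
Proof. tauto. Qed.

Lemma imp_iff (A B C D : Prop) :
  (A <-> B) -> (C <-> D) -> ((A -> C) <-> (B -> D)).
Proof. tauto. Qed.

(** * Meaning of the formulas *)

Section Holds.
Variable M : nat.
Implicit Types (A B : formula) (s : seq nat) (k i j a b : nat).

Lemma holds_ExP A s :
  (exists a, a < 2 ^ M /\ holds M A (rcons s a)) <-> holds M (Ex A) s.
Proof.
split=> [[a [lta Aa]] | /hasP[a]].
  by apply/hasP; exists a; rewrite // mem_iota.
by rewrite mem_iota => lta Aa; exists a.
Qed.

Lemma holds_AndP A B s : holds M A s /\ holds M B s <-> holds M (And A B) s.
Proof. by split=> /andP. Qed.

Lemma holds_NotP A s : ~ holds M A s <-> holds M (Not A) s.
Proof. by split=> /negP. Qed.

Lemma holds_OrP A B s : holds M A s \/ holds M B s <-> holds M (Or A B) s.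
Proof. by rewrite /= negb_and !negbK; split=> /orP. Qed.

Lemma holds_ImpP A B s : (holds M A s -> holds M B s) <-> holds M (Imp A B) s.
Proof. by rewrite /= negb_and negbK -implybE; split=> /implyP. Qed.

Lemma holds_AllP A s :
  (forall a, a < 2 ^ M -> holds M A (rcons s a)) <-> holds M (All A) s.
Proof.
rewrite /= -all_predC; split=> [Aa|/allP Aa a lta].
  by apply/allP => a; rewrite mem_iota /= negbK; apply: Aa.
by have := Aa a; rewrite mem_iota /= negbK; apply.
Qed.

Lemma holds_Lt s i j a b : valued s i a -> valued s j b ->
  a < b <-> holds M (Lt i j) s.
Proof. by move=> [_ <-] [_ <-]. Qed.

Lemma holds_In s i j a b : valued s i a -> valued s j b ->
  bit b a <-> holds M (In i j) s.
Proof. by move=> [_ <-] [_ <-]. Qed.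

Lemma holds_Eq s i j a b : valued s i a -> valued s j b ->
  a = b <-> holds M (Eq i j) s.
Proof. by move=> [_ <-] [_ <-] /=; lia. Qed.

Lemma holds_IsZero k s i a : in_range M k s -> valued s i a ->
  a = 0 <-> holds M (IsZero k i) s.
Proof.
move=> rs va; rewrite -holds_NotP -holds_ExP.
have -> : (exists b, b < 2 ^ M /\ holds M (Lt k i) (rcons s b)) <->
    (exists b, b < 2 ^ M /\ b < a).
  apply: ex_bounded_iff => b ltb; apply: iff_sym.
  by apply: holds_Lt; solve_context.
split=> [-> [b []]//|nA]; case: (posnP a) => // a0; case: nA.
by exists 0; rewrite expn_gt0.
Qed.

Lemma holds_IsSucc k s i j a b : in_range M k s -> valued s i a -> valued s j b ->
  b = a.+1 <-> holds M (IsSucc k i j) s.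
Proof.
move=> rs va vb; have ltb := valued_lt rs vb.
rewrite -holds_AndP -holds_NotP -holds_ExP.
have -> : (exists c, c < 2 ^ M /\ holds M (And (Lt i k) (Lt k j)) (rcons s c)) <->
    (exists c, c < 2 ^ M /\ (a < c /\ c < b)).
  apply: ex_bounded_iff => c ltc; apply: iff_sym; rewrite -holds_AndP.
  by apply: and_iff; apply: holds_Lt; solve_context.
have <- := holds_Lt va vb.
split=> [bE|[ltab nA]]; first by split; [rewrite bE | move=> [c]; lia].
by have [//|neq] := eqVneq b a.+1; case: nA; exists a.+1; lia.
Qed.

(** Extensionality below [2 ^ M] suffices: [a], [b] and every bit position set in [c] are below that
    bound. *)
Lemma holds_IsUPair k s e i j c a b :
  in_range M k s -> valued s e c -> valued s i a -> valued s j b ->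
  c = upair a b <-> holds M (IsUPair k e i j) s.
Proof.
move=> rs vc va vb; have ltc := valued_lt rs vc.
have lta := valued_lt rs va; have ltb := valued_lt rs vb.
have inE t : t < 2 ^ M -> (bit c t <-> t = a \/ t = b) <->
    holds M (And (Imp (In k e) (Or (Eq k i) (Eq k j)))
           (Imp (Or (Eq k i) (Eq k j)) (In k e))) (rcons s t).
  move=> ltt; rewrite -holds_AndP; apply: and_iff; rewrite -holds_ImpP.
    apply: imp_iff; first by apply: holds_In; solve_context.
    by rewrite -holds_OrP; apply: or_iff; apply: holds_Eq; solve_context.
  apply: imp_iff; last by apply: holds_In; solve_context.
  by rewrite -holds_OrP; apply: or_iff; apply: holds_Eq; solve_context.
rewrite -holds_AllP; split=> [cE t ltt|H].
  rewrite -inE // cE bit_upair; split=> [/orP[]/eqP|[]->]; rewrite ?eqxx ?orbT; auto.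
apply: bit_inj => t; rewrite bit_upair; apply/idP/orP => [ct|tab].
  have ltt : t < 2 ^ M by apply: ltn_trans (bit_lt ltc ct) (ltn_expl _ _).
  by case: (proj1 (proj2 (inE t ltt) (H t ltt)) ct) => ->; rewrite eqxx; auto.
have ltt : t < 2 ^ M by case: tab => /eqP->.
by apply: (proj2 (proj2 (inE t ltt) (H t ltt))); case: tab => /eqP; auto.
Qed.

(** The two inner pairs are members of [c], so the bounded quantifiers reach them. *)
Lemma holds_IsOPair k s e i j c a b :
  in_range M k s -> valued s e c -> valued s i a -> valued s j b ->
  c = opair a b <-> holds M (IsOPair k e i j) s.
Proof.
move=> rs vc va vb; have ltc := valued_lt rs vc.
have exE : (exists x, x < 2 ^ M /\ exists y, y < 2 ^ M /\
    ((x = upair a a /\ y = upair a b) /\ c = upair x y)) <->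
    holds M (IsOPair k e i j) s.
  rewrite -holds_ExP; apply: ex_bounded_iff => x ltx.
  rewrite -holds_ExP; apply: ex_bounded_iff => y lty.
  rewrite -holds_AndP; apply: and_iff; last by apply: holds_IsUPair; solve_context.
  by rewrite -holds_AndP; apply: and_iff; apply: holds_IsUPair; solve_context.
rewrite -exE; split=> [cE|[x [_ [y [_ [[-> ->] ->]]]]] //].
have ltM t : bit c t -> t < 2 ^ M.
  by move=> ct; apply: ltn_trans (bit_lt ltc ct) (ltn_expl _ _).
exists (upair a a); split; first by apply: ltM; rewrite cE bit_upair eqxx.
exists (upair a b); split; first by apply: ltM; rewrite cE bit_upair eqxx orbT.
by [].
Qed.

Lemma holds_iter_ExP m A s :
  (exists w, [/\ size w = m, all (fun a => a < 2 ^ M) w & holds M A (s ++ w)]) <->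
  holds M (iter m Ex A) s.
Proof.
elim: m s => [|m IHm] s /=.
  split=> [[w [/size0nil-> _]]|As]; first by rewrite cats0.
  by exists [::]; rewrite cats0.
rewrite -/(holds M (Ex (iter m Ex A)) s) -holds_ExP; split.
  move=> [[|a w] [] //= [sz] /andP[lta ltw] Aw]; exists a; split=> //.
  by rewrite -IHm; exists w; rewrite cat_rcons.
move=> [a [lta /IHm[w [sz ltw Aw]]]]; exists (a :: w).
by rewrite /= sz lta -cat_rcons.
Qed.

(** The formula [Not (Lt 0 0)] is always true and plays the empty conjunction. *)
Lemma holds_conjP (I : finType) (F : I -> formula) s :
  (forall x, holds M (F x) s) <->
  holds M (foldr And (Not (Lt 0 0)) [seq F x | x <- enum I]) s.
Proof.
have -> : holds M (foldr And (Not (Lt 0 0)) [seq F x | x <- enum I]) s =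
    all (fun x => holds M (F x) s) (enum I).
  by elim: (enum I) => [|x r IHr] /=; rewrite ?ltnn ?IHr.
split=> [Fs|/allP Fs x]; first by apply/allP.
by apply: Fs; rewrite mem_enum.
Qed.

End Holds.

(* [compile f k vs y] expresses, in a context of [k] variables, that [f] maps
   the values of the variables [vs] to the value of the variable [y].  For
   [PrimRec] it asserts the existence of a set of pairs (index, value) closed
   under taking predecessors in the recursion. *)
Fixpoint compile n (f : recfun n) (k : nat) (vs : seq nat) (y : nat) : formula :=
  match f with
  | Zero _ => IsZero k y
  | Succ => IsSucc k (nth 0 vs 0) y
  | Proj _ i => Eq (nth 0 vs i) y
  | Comp _ m f h =>
      iter m Ex (And
        (foldr And (Not (Lt 0 0))
           [seq compile (h i) (k + m) vs (k + i) | i <- enum 'I_m])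
        (compile f (k + m) (iota k m) y))
  | PrimRec _ f h =>
      Ex (And
        (Ex (And (In k.+1 k) (IsOPair k.+2 k.+1 (nth 0 vs 0) y)))
        (All (All (All (Imp
           (And (In k.+1 k) (IsOPair k.+4 k.+1 k.+2 k.+3))
           (Or (And (IsZero k.+4 k.+2) (compile f k.+4 (behead vs) k.+3))
               (Ex (Ex (Ex (And
                  (And (IsSucc k.+4.+3 k.+4 k.+2)
                       (And (In k.+4.+2 k)
                            (IsOPair k.+4.+3 k.+4.+2 k.+4 k.+4.+1)))
                  (compile h k.+4.+3 (k.+4 :: k.+4.+1 :: behead vs)
                           k.+3)))))))))))
  | Mu _ f =>
      Ex (And
        (And (IsZero k.+1 k) (compile f k.+1 (y :: vs) k))
        (All (Imp (Lt k.+1 y)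
           (Ex (And (Lt k k.+2) (compile f k.+3 (k.+1 :: vs) k.+2))))))
  end.

(** The content of [compile] as a proposition about numbers, clause by clause, free of variable
    levels. In [PrimRec], [c] codes the set of pairs; in [Mu], [o] names zero. *)
Fixpoint bounded_evaluates (M n : nat) (f : recfun n) : seq nat -> nat -> Prop :=
  match f with
  | Zero _ => fun _ y => y = 0
  | Succ => fun v y => y = (nth 0 v 0).+1
  | Proj _ i => fun v y => nth 0 v i = y
  | Comp _ m f h => fun v y =>
      exists w, [/\ size w = m, all (fun a => a < 2 ^ M) w &
        (forall i, bounded_evaluates M (h i) v (nth 0 w i)) /\
        bounded_evaluates M f w y]
  | PrimRec _ f h => fun v y =>
      exists c, c < 2 ^ M /\
        ((exists p, p < 2 ^ M /\ (bit c p /\ p = opair (nth 0 v 0) y)) /\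
         (forall p, p < 2 ^ M -> forall i, i < 2 ^ M -> forall z, z < 2 ^ M ->
            bit c p /\ p = opair i z ->
            i = 0 /\ bounded_evaluates M f (behead v) z \/
            exists i', i' < 2 ^ M /\ exists z', z' < 2 ^ M /\
            exists p', p' < 2 ^ M /\
              ((i = i'.+1 /\ (bit c p' /\ p' = opair i' z')) /\
               bounded_evaluates M h [:: i', z' & behead v] z)))
  | Mu _ f => fun v y =>
      exists o, o < 2 ^ M /\
        ((o = 0 /\ bounded_evaluates M f (y :: v) o) /\
         (forall z, z < 2 ^ M -> z < y ->
            exists b, b < 2 ^ M /\ (o < b /\ bounded_evaluates M f (z :: v) b)))
  end.

(** Both sides have the same logical shape, so the congruence rules lead to atomic formulas and
    induction hypotheses. *)
Lemma holds_compile M n (f : recfun n) k vs y s v w :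
  in_range M k s -> size vs = n -> all_valued s vs v -> valued s y w ->
  bounded_evaluates M f v w <-> holds M (compile f k vs y) s.
Proof.
elim: f k vs y s v w => [{}n||{}n i|{}n m f IHf h IHh|{}n f IHf h IHh|{}n f IHf]
  k vs y s v w rs sz vv vw.
- exact: holds_IsZero rs vw.
- by apply: (holds_IsSucc rs _ vw); apply: all_valued_nth vv _; rewrite sz.
- by apply: holds_Eq vw; apply: all_valued_nth vv _; rewrite sz.
- rewrite [compile _ _ _ _]/= -holds_iter_ExP /=.
  have szs : size s = k by case/andP: rs => /eqP.
  have and3_iff (A B C D : Prop) : (A -> B -> C <-> D) -> [/\ A, B & C] <-> [/\ A, B & D].
    by move=> CD; split=> -[a b /(CD a b)].
  (* The [m] quantifiers append the inner values [u] at the levels from [k] to [k + m - 1]. *)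
  suff inE u : size u = m -> all (fun a => a < 2 ^ M) u ->
      (forall i, bounded_evaluates M (h i) v (nth 0 u i)) /\ bounded_evaluates M f u w <->
      holds M (And
        (foldr And (Not (Lt 0 0))
           [seq compile (h i) (k + m) vs (k + i) | i <- enum 'I_m])
        (compile f (k + m) (iota k m) y)) (s ++ u).
    by split=> -[u H]; exists u; move: H; apply and3_iff => szu ltu; rewrite inE.
  move=> szu ltu.
  have rsu : in_range M (k + m) (s ++ u).
    by rewrite /in_range size_cat all_cat szs szu eqxx ltu andbT; case/andP: rs.
  have vu : all_valued (s ++ u) (iota k m) u.
    split; first by apply/allP => i; rewrite mem_iota size_cat szs szu => /andP[].
    apply: (@eq_from_nth _ 0); rewrite size_map size_iota ?szu // => i lti.
    by rewrite (nth_map 0) ?size_iota // nth_iota // nth_cat szs ltnNge leq_addr addKn.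
  have vwu : valued (s ++ u) y w.
    by case: vw => lty <-; rewrite /valued size_cat ltn_addr // nth_cat lty.
  rewrite -holds_AndP; apply: and_iff; last by apply: IHf; rewrite ?size_iota.
  have vi (i : 'I_m) : valued (s ++ u) (k + i) (nth 0 u i).
    by rewrite /valued size_cat szs szu ltn_add2l ltn_ord nth_cat szs ltnNge leq_addr addKn.
  have vvu := all_valued_cat u vv.
  rewrite -holds_conjP; split=> H i; have := H i;
    by rewrite (IHh i _ _ _ _ _ _ rsu sz vvu (vi i)).
- rewrite [compile _ _ _ _]/= -holds_ExP; apply: ex_bounded_iff => c ltc.
  rewrite -holds_AndP; apply: and_iff.
    rewrite -holds_ExP; apply: ex_bounded_iff => p ltp.
    rewrite -holds_AndP; apply: and_iff; first by apply: holds_In; solve_context.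
    apply: holds_IsOPair; try solve_context.
    do 2 apply: valued_rcons; apply: all_valued_nth vv _; by rewrite sz.
  rewrite -holds_AllP; apply: all_bounded_iff => p ltp.
  rewrite -holds_AllP; apply: all_bounded_iff => i lti.
  rewrite -holds_AllP; apply: all_bounded_iff => z ltz.
  rewrite -holds_ImpP; apply: imp_iff.
    rewrite -holds_AndP; apply: and_iff; first by apply: holds_In; solve_context.
    by apply: holds_IsOPair; solve_context.
  rewrite -holds_OrP; apply: or_iff.
    rewrite -holds_AndP; apply: and_iff; first by apply: holds_IsZero; solve_context.
    by apply: IHf; rewrite ?size_behead ?sz //; solve_context.
  rewrite -holds_ExP; apply: ex_bounded_iff => i' lti'.
  rewrite -holds_ExP; apply: ex_bounded_iff => z' ltz'.
  rewrite -holds_ExP; apply: ex_bounded_iff => p' ltp'.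
  rewrite -holds_AndP; apply: and_iff.
    rewrite -holds_AndP; apply: and_iff; first by apply: holds_IsSucc; solve_context.
    rewrite -holds_AndP; apply: and_iff; first by apply: holds_In; solve_context.
    by apply: holds_IsOPair; solve_context.
  by apply: IHh; rewrite /= ?size_behead ?sz //; solve_context.
- rewrite [compile _ _ _ _]/= -holds_ExP; apply: ex_bounded_iff => o lto.
  rewrite -holds_AndP; apply: and_iff.
    rewrite -holds_AndP; apply: and_iff; first by apply: holds_IsZero; solve_context.
    by apply: IHf; rewrite /= ?sz //; solve_context.
  rewrite -holds_AllP; apply: all_bounded_iff => z ltz.
  rewrite -holds_ImpP; apply: imp_iff; first by apply: holds_Lt; solve_context.
  rewrite -holds_ExP; apply: ex_bounded_iff => b ltb.
  rewrite -holds_AndP; apply: and_iff; first by apply: holds_Lt; solve_context.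
  by apply: IHf; rewrite /= ?sz //; solve_context.
Qed.

(** * Soundness and completeness of bounded evaluation *)

Definition recurses (P : nat -> Prop) (Q : nat -> nat -> nat -> Prop) :=
  fix rec (m y : nat) : Prop :=
    if m is m'.+1 then exists z, rec m' z /\ Q m' z y else P y.

(** Naming the anonymous fixpoint inside [evaluates] makes induction on the recursion variable
    possible. *)
Lemma evaluates_PrimRec n (f : recfun n) (h : recfun n.+2) (v : n.+1.-tuple nat) y :
  evaluates (PrimRec f h) v y =
  recurses (evaluates f [tuple of behead v])
    (fun i z => evaluates h [tuple of [:: i, z & [tuple of behead v]]]) (thead v) y.
Proof. by []. Qed.

Lemma theadE n (v : n.+1.-tuple nat) : thead v = nth 0 v 0.
Proof. exact: tnth_nth. Qed.

(** All intermediate values are bounded, so the induction hypotheses apply. In [Mu], the bound on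
    [y] puts all smaller arguments within the range of the quantifier. *)
Lemma bounded_evaluates_sound M n (f : recfun n) (v : n.-tuple nat) y :
  y < 2 ^ M -> bounded_evaluates M f v y -> evaluates f v y.
Proof.
elim: f v y => [{}n||{}n i|{}n m f IHf h IHh|{}n f IHf h IHh|{}n f IHf] v y lty //.
- by rewrite /= theadE.
- by rewrite /= (tnth_nth 0).
- move=> [w [/eqP szw /allP ltw [hw fw]]].
  exists (Tuple szw); split; last exact: IHf.
  move=> i; rewrite (tnth_nth 0); apply: IHh; last exact: hw.
  by apply/ltw/mem_nth; rewrite (eqP szw).
- move=> [c [_ [[p [ltp [cp pE]]] closed]]]; rewrite evaluates_PrimRec theadE.
  (* Members of a coded set are below its code, so the components inherit the bound of the pair. *)
  have lt2 i z : opair i z < 2 ^ M -> i < 2 ^ M /\ z < 2 ^ M.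
    move=> lt; have lt' : upair i z < 2 ^ M.
      by apply: ltn_trans (bit_lt lt _) (ltn_expl _ _); rewrite // bit_upair eqxx orbT.
    by split; apply: ltn_trans (bit_lt lt' _) (ltn_expl _ _); rewrite // bit_upair eqxx ?orbT.
  move: (nth 0 v 0) => m in pE *.
  (* The value and the pair are generalized, since closedness leads to another member of [c]. *)
  elim: m y {lty} p ltp cp pE => [|m IHm] z p ltp cp pE.
    have [lti ltz] := lt2 _ _ (eq_ind _ (fun x => is_true (x < _)) ltp _ pE).
    case: (closed p ltp 0 lti z ltz (conj cp pE)) => [[_ fz]|[i' [_ [z' [_ [p' [_ [[//]]]]]]]]].
    exact: IHf.
  have [lti ltz] := lt2 _ _ (eq_ind _ (fun x => is_true (x < _)) ltp _ pE).
  case: (closed p ltp _ lti z ltz (conj cp pE)) => [[//]|].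
  move=> [i' [_ [z' [_ [p' [ltp' [[[<-] [cp' p'E]] hz]]]]]]].
  by exists z'; split; [exact: IHm cp' p'E | exact: IHh].
- move=> [o [_ [[-> fo] pos]]]; split; first by apply: IHf fo; rewrite expn_gt0.
  move=> z ltz; have [[|b] [ltb [// _ fb]]] := pos z (ltn_trans ltz lty) ltz.
  by exists b; apply: IHf.
Qed.

Definition eventually (P : nat -> Prop) := exists M0, forall M, M0 <= M -> P M.

Lemma eventually_and P Q :
  eventually P -> eventually Q -> eventually (fun M => P M /\ Q M).
Proof.
move=> [a Pa] [b Qb]; exists (maxn a b) => M; rewrite geq_max => /andP[leaM lebM].
by split; [exact: Pa | exact: Qb].
Qed.

Lemma eventually_imp (P Q : nat -> Prop) :
  (forall M, P M -> Q M) -> eventually P -> eventually Q.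
Proof. by move=> PQ [a Pa]; exists a => M /Pa /PQ. Qed.

Lemma eventually_lt a : eventually (fun M => a < 2 ^ M).
Proof. by exists a => M leaM; apply: leq_ltn_trans leaM (ltn_expl _ _). Qed.

Lemma eventually_all m (P : nat -> nat -> Prop) :
  (forall i, i < m -> eventually (P i)) ->
  eventually (fun M => forall i, i < m -> P i M).
Proof.
elim: m => [|m IHm] Pi; first by exists 0.
apply: eventually_imp (eventually_and (IHm _) (Pi m _)) => // [M [PM PmM] i|i lti].
  by rewrite ltnS leq_eqVlt => /predU1P[->|/PM].
exact/Pi/ltnW.
Qed.

Lemma eventually_all_lt (w : seq nat) :
  eventually (fun M => all (fun a => a < 2 ^ M) w).
Proof.
elim: w => [|a w IHw]; first by exists 0.
by apply: eventually_imp (eventually_and (eventually_lt a) IHw) => M [/= -> ->].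
Qed.

(** An evaluation involves finitely many witnesses. Asserting the conclusion for all large [M] lets
    the subevaluations be combined. *)
Lemma bounded_evaluates_complete n (f : recfun n) (v : n.-tuple nat) y :
  evaluates f v y -> eventually (fun M => bounded_evaluates M f v y).
Proof.
elim: f v y => [{}n||{}n i|{}n m f IHf h IHh|{}n f IHf h IHh|{}n f IHf] v y.
- by exists 0.
- by move=> /= yE; exists 0 => M _; rewrite yE theadE.
- by move=> /= yE; exists 0 => M _; rewrite yE (tnth_nth 0).
- move=> [w [hw /IHf fw]].
  (* The extra proof argument rebuilds the ordinal that indexes [h]. *)
  have {}hw : eventually (fun M => forall i, i < m -> forall lti : i < m,
      bounded_evaluates M (h (Ordinal lti)) v (nth 0 w i)).
    apply: eventually_all => i lti; have := IHh _ _ _ (hw (Ordinal lti)).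
    rewrite (tnth_nth 0) /=; apply: eventually_imp => M hM lti'.
    by rewrite (bool_irrelevance lti' lti).
  apply: eventually_imp (eventually_and (eventually_all_lt w) (eventually_and fw hw)).
  move=> M [ltw [fM hM]]; exists w; split=> //; first exact: size_tuple.
  by split=> // -[i lti]; apply: hM.
- rewrite evaluates_PrimRec theadE; set params := [tuple of behead v] => rec.
  pose closed c M := forall p, p < 2 ^ M -> forall i, i < 2 ^ M ->
    forall z, z < 2 ^ M -> bit c p /\ p = opair i z ->
    i = 0 /\ bounded_evaluates M f params z \/
    exists i', i' < 2 ^ M /\ exists z', z' < 2 ^ M /\ exists p', p' < 2 ^ M /\
      ((i = i'.+1 /\ (bit c p' /\ p' = opair i' z')) /\
       bounded_evaluates M h [:: i', z' & params] z).
  (* The set [c] is chosen before [M], so that it eventually falls below [2 ^ M]. *)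
  suff [c [cy cl]] : exists c, bit c (opair (nth 0 v 0) y) /\ eventually (closed c).
    apply: eventually_imp (eventually_and (eventually_lt c) (eventually_and
      (eventually_lt (opair (nth 0 v 0) y)) cl)) => M [ltc [ltp clM]].
    by exists c; split=> //; split=> //; exists (opair (nth 0 v 0) y).
  elim: (nth 0 v 0) y rec => [|m IHm] y /=.
    (* At index 0 the singleton of the pair [(0, y)] is closed. *)
    move=> /IHf fy; exists (2 ^ opair 0 y); rewrite bit_pow2 eqxx; split=> //.
    apply: eventually_imp fy => M fy p _ i _ z _ [].
    by rewrite bit_pow2 => /eqP-> /opair_inj[<- <-]; left.
  move=> [z [/IHm[c [cz cl]] /IHh hy]].
  (* The new pair is adjoined; old members keep their predecessors, and the new one has [(m, z)]. *)
  exists (bitwise2 orb c (2 ^ opair m.+1 y)).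
  have cE p : bit (bitwise2 orb c (2 ^ opair m.+1 y)) p =
      bit c p || (p == opair m.+1 y) by rewrite bit_bitwise2 // bit_pow2.
  rewrite cE eqxx orbT; split=> //.
  apply: eventually_imp (eventually_and (eventually_and hy cl) (eventually_and
    (eventually_lt m) (eventually_and (eventually_lt z) (eventually_lt (opair m z))))).
  move=> M [[hM clM] [ltm [ltz ltp]]] p ltpM i lti a lta [].
  rewrite cE => /orP[cp|/eqP->] pE.
    case: (clM p ltpM i lti a lta (conj cp pE)); first by left.
    move=> [i' [lti' [z' [ltz' [p' [ltp' [[iE [cp' p'E]] ha]]]]]]]; right.
    exists i'; split=> //; exists z'; split=> //; exists p'; split=> //.
    by rewrite cE cp'.
  have [<- <-] := opair_inj pE; right.
  exists m; split=> //; exists z; split=> //; exists (opair m z); split=> //.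
  by rewrite cE cz.
- move=> [/IHf fy pos].
  have {}pos : eventually (fun M => forall z, z < y ->
      exists b, b < 2 ^ M /\ (0 < b /\ bounded_evaluates M f (z :: v) b)).
    apply: eventually_all => z /pos[b /IHf fb].
    apply: eventually_imp (eventually_and (eventually_lt b.+1) fb) => M [ltb fM].
    by exists b.+1.
  apply: eventually_imp (eventually_and fy pos) => M [fM posM].
  exists 0; rewrite expn_gt0; split=> //; split=> // z _; exact: posM.
Qed.

Theorem theorem5 (S : nat -> Prop) (hS : recursively_enumerable S) :
  exists f : nat -> nat,
    bigO f (fun _ => 1) /\ aram_recognizes add_div_shift_bool S f.
Proof.
(* Variable 0 is the input and variable 1 the value of [f]: the formula asserts convergence with
   bounded witnesses. *)
case: hS => f SE; pose A := Ex (compile f 2 [:: 0] 1).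
apply: definable_recognizes (definable_holds A) _ => inp.
have holdsE x : holds (scale (inp, x)) A [:: inp] <->
    exists y, y < 2 ^ scale (inp, x) /\ bounded_evaluates (scale (inp, x)) f [:: inp] y.
  rewrite -holds_ExP; apply: ex_bounded_iff => y lty.
  apply: iff_sym; apply: holds_compile => //.
  rewrite /in_range /= lty !andbT.
  by apply: leq_ltn_trans (leq_addr x inp) (ltn_expl _ _).
split=> [/SE[y /bounded_evaluates_complete ev]|nS].
  have [M0 PM] := eventually_and (eventually_lt y) ev.
  (* Only [x] below [M0] can fail, because the scale is at least [x]. *)
  exists (iota 0 M0) => x; rewrite mem_iota /= -leqNgt => leMx.
  apply/holdsE; exists y; apply: PM.
  exact: leq_trans leMx (leq_addl _ _).
(* By soundness no [x] leads to a false acceptance, so there are no exceptions. *)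
exists [::] => x _; apply/negbTE/negP => /holdsE[y [lty ev]].
apply: nS; apply/SE; exists y.
exact: (@bounded_evaluates_sound _ _ _ [tuple inp] _ lty) ev.
Qed.
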